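(* Let $\Gamma$ be a countable amenable group with a fixed Følner sequence $\{F_n\}_{n\ge1}$, and let $\pi\colon X\to Y$ be a factor map between dynamical systems of $\Gamma$. For every $y\in Y$, $$\operatorname{mdim}(\pi^{-1}(y),\Gamma)\le\operatorname{mdim}(X|Y).$$
   Context: $\Gamma$ is a countable amenable group and $\mathcal F(\Gamma)$ is the set of nonempty finite subsets of $\Gamma$. For $K\in\mathcal F(\Gamma)$ and $\delta>0$, $\mathcal B(K,\delta)$ is the set of $F\in\mathcal F(\Gamma)$ with $|\{t\in F: Kt\subseteq F\}|\ge(1-\delta)|F|$. For a real-valued $\varphi$ on $\mathcal F(\Gamma)$, $\lim_F\varphi(F)=c$ means: for every $\varepsilon>0$ there are $K\in\mathcal F(\Gamma)$, $\delta>0$ with $|\varphi(F)-c|<\varepsilon$ for all $F\in\mathcal B(K,\delta)$. A Følner sequence is a sequence $\{F_n\}_{n\ge1}$ in $\mathcal F(\Gamma)$ with $|sF_n\Delta F_n|/|F_n|\to0$ for every $s\in\Gamma$. A dynamical system $\Gamma\curvearrowright X$ is a (nonempty) compact metrizable space $X$ with a continuous action of $\Gamma$. A factor map $\pi\colon X\to Y$ is a continuous $\Gamma$-equivariant surjection. For a finite open cover $\mathcal U$ of a space $X$, $\operatorname{ord}(\mathcal U)=\max_{x\in X}\sum_{U\in\mathcal U}1_U(x)-1$. For families of sets, $\mathcal U\vee\mathcal V=\{U\cap V:U\in\mathcal U,V\in\mathcal V\}$, and $\mathcal U$ refines $\mathcal V$ if every element of $\mathcal U$ is contained in some element of $\mathcal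 V$. For $F\in\mathcal F(\Gamma)$, $\mathcal U^F=\bigvee_{s\in F}s^{-1}\mathcal U$. $\mathcal D(\mathcal U)$ is the minimum of $\operatorname{ord}(\mathcal W)$ over all finite open covers $\mathcal W$ of the space refining $\mathcal U$; $\mathcal D(\mathcal U|Y)$ is the minimum of $\operatorname{ord}(\mathcal W)$ over all finite open covers $\mathcal W$ of $X$ such that $\{\pi^{-1}(y)\}_{y\in Y}\vee\mathcal W$ refines $\mathcal U$. The limit $\lim_F\mathcal D(\mathcal U^F|Y)/|F|$ exists, and the conditional mean dimension is $$\operatorname{mdim}(X|Y)=\sup_{\mathcal U}\lim_F\frac{\mathcal D(\mathcal U^F|Y)}{|F|}\in[0,\infty].$$ For a closed subset $K\subseteq X$, $\mathcal U|_K=\{U\cap K:U\in\mathcal U\}$ is the induced open cover of $K$, and $$\operatorname{mdim}(K,\Gamma)=\sup_{\mathcal U}\liminf_{n\to\infty}\frac{\mathcal D(\mathcal U^{F_n}|_K)}{|F_n|}.$$ In both suprema $\mathcal U$ ranges over all finite open covers of $X$. *)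

(* Defs.v *)
From HB Require Import structures.
From mathcomp Require Import all_boot all_order all_algebra finmap.
From mathcomp Require Import all_classical all_reals all_analysis.

Set Implicit Arguments.
Unset Strict Implicit.
Unset Printing Implicit Defensive.

Import Order.TTheory GRing.Theory Num.Theory.
Import numFieldNormedType.Exports.

Local Open Scope classical_set_scope.
Local Open Scope ring_scope.

Definition ltrans (G : groupType) (s : G) (F : {fset G}) : {fset G} :=
  [fset (s * t)%g | t in F]%fset.

Definition rtrans (G : groupType) (K : {fset G}) (t : G) : {fset G} :=
  [fset (s * t)%g | s in K]%fset.

Definition symdiff (T : choiceType) (A B : {fset T}) : {fset T} :=
  ((A `\` B) `|` (B `\` A))%fset.

Definition invariant_fsets (R : realType) (G : groupType) (K : {fset G})
    (delta : R) : set {fset G} :=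
  [set F | F != fset0 /\
    (1 - delta) * #|` F |%:R
      <= #|` [fset t in F | (rtrans K t `<=` F)%fset]%fset |%:R].

(* [phi @ amenable_filter R --> c] is the convergence lim_F phi(F) = c
   "as F becomes more and more invariant". *)
Definition amenable_filter (R : realType) (G : groupType) :
    set_system {fset G} :=
  filter_from [set p : {fset G} * R | p.1 != fset0 /\ 0 < p.2]
    (fun p => invariant_fsets p.1 p.2).
Arguments amenable_filter R {G}.

Definition folner_sequence (R : realType) (G : groupType)
    (F : nat -> {fset G}) : Prop :=
  (forall n, F n != fset0) /\
  forall s : G, #|` symdiff (ltrans s (F n)) (F n) |%:R / #|` F n |%:R
    @[n --> \oo] --> (0 : R).

Definition amenable (R : realType) (G : groupType) : Prop :=
  exists F : nat -> {fset G}, folner_sequence R F.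

Definition metrizable (R : realType) (T : topologicalType) : Prop :=
  exists d : T -> T -> R,
    [/\ forall x y, d x y = 0 <-> x = y,
        forall x y, d x y = d y x,
        forall x y z, d x z <= d x y + d y z &
        forall (x : T) (A : set T),
          nbhs x A <-> exists2 e : R, 0 < e & [set y | d x y < e] `<=` A].

(* The group is discrete, so an action is continuous when each of its
   elements acts continuously. *)
Definition continuous_action (G : groupType) (X : topologicalType)
    (act : G -> X -> X) : Prop :=
  [/\ forall x, act 1%g x = x,
      forall s t x, act (s * t)%g x = act s (act t x) &
      forall s, continuous (act s)].

Definition dynamical_system (R : realType) (G : groupType)
    (X : topologicalType) (act : G -> X -> X) : Prop :=
  [/\ [set: X] !=set0, compact [set: X], metrizable R X &
      continuous_action act].

Definition factor_map (G : groupType) (X Y : topologicalType)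
    (actX : G -> X -> X) (actY : G -> Y -> Y) (pi : X -> Y) : Prop :=
  [/\ continuous pi,
      forall s x, pi (actX s x) = actY s (pi x) &
      range pi = [set: Y]].

(* Finite families of relatively open subsets of A with union A; for
   A = [set: X] these are the finite open covers of the space X, and in
   general those of the subspace A, its open sets being regarded as subsets
   of X. *)
Definition finite_open_cover (X : topologicalType) (A : set X)
    (W : set (set X)) : Prop :=
  [/\ finite_set W, open_fam_of A W id & cover W id = A].

Definition multiplicity (X : choiceType) (W : set (set X)) (x : X) : nat :=
  #|` fset_set [set U | W U /\ U x] |.

(* The supremum is a maximum when W is finite and A is nonempty. *)
Definition cover_ord (R : realType) (X : choiceType) (A : set X)
    (W : set (set X)) : R :=
  sup [set (multiplicity W x)%:R | x in A] - 1.

Definition cover_join (X : Type) (U V : set (set X)) : set (set X) :=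
  [set A `&` B | A in U & B in V].

Definition refines (X : Type) (U V : set (set X)) : Prop :=
  forall A, U A -> exists2 B, V B & A `<=` B.

(* The preimage of u under the homeomorphism act s is s^-1 u.  The family
   [set setT] is neutral for the join. *)
Definition iterated_cover (G : groupType) (X : Type) (act : G -> X -> X)
    (U : set (set X)) (F : {fset G}) : set (set X) :=
  \big[@cover_join X/[set setT]]_(s <- F) [set act s @^-1` u | u in U].

Definition restrict_cover (X : Type) (K : set X) (U : set (set X)) :
    set (set X) :=
  [set u `&` K | u in U].

Definition fibers (X Y : Type) (pi : X -> Y) : set (set X) :=
  [set pi @^-1` [set y] | y in [set: Y]].

(* D(U) on the subspace A.  The infima here and in [cover_dim_rel] are over
   sets of integers bounded below, hence minima. *)
Definition cover_dim (R : realType) (X : topologicalType) (A : set X)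
    (U : set (set X)) : R :=
  inf [set cover_ord R A W | W in
    [set W | finite_open_cover A W /\ refines W U]].

(* D(U|Y). *)
Definition cover_dim_rel (R : realType) (X : topologicalType) (Y : Type)
    (pi : X -> Y) (U : set (set X)) : R :=
  inf [set cover_ord R [set: X] W | W in
    [set W | finite_open_cover [set: X] W
             /\ refines (cover_join (fibers pi) W) U]].

Definition mdim_cond (R : realType) (G : groupType) (X : topologicalType)
    (Y : Type) (act : G -> X -> X) (pi : X -> Y) : \bar R :=
  ereal_sup
    [set (lim (cover_dim_rel R pi (iterated_cover act U E) / #|` E |%:R
             @[E --> amenable_filter R]))%:E
    | U in finite_open_cover [set: X]].

Definition mdim_subset (R : realType) (G : groupType) (X : topologicalType)
    (act : G -> X -> X) (F_ : nat -> {fset G}) (K : set X) : \bar R :=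
  ereal_sup
    [set limn_einf (fun n =>
       (cover_dim R K (restrict_cover K (iterated_cover act U (F_ n)))
          / #|` F_ n |%:R)%:E)
    | U in finite_open_cover [set: X]].

(* Main.v *)
(** For the fiber [K] over [y], a cover of [X] realizing [D(U^F | Y)] restricts
    to a cover of [K] refining [U^F|_K], so [D(U^F|_K) <= D(U^F | Y)], and one
    concludes by evaluating along the Følner sequence.  The substance is that
    the limit defining [mdim(X | Y)] exists ([lim] is a junk value otherwise).
    This is the Ornstein-Weiss theorem for [F |-> D(U^F | Y)], a right-invariant
    function which is subadditive because [D(U \/ V | Y) <= D(U | Y) + D(V | Y)].

    Ornstein-Weiss: given sets [T_1, ..., T_k], each very invariant under the
    previous ones, with [h(T_i) / |T_i|] close to the lower limit, fill a very
    invariant [F] greedily with almost disjoint translates of [T_k], then what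
    remains with translates of [T_(k-1)], and so on; each step divides the
    uncovered part by a definite factor.

    Subadditivity of [D]: two partitions of unity cut the same segment into
    intervals in two ways.  The pairs of intervals that meet index a common
    refinement, and [a] intervals meet [b] intervals in at most [a + b - 1]
    pairs. *)

Require Import Defs.
From mathcomp Require Import all_boot all_order all_algebra finmap.
From mathcomp Require Import all_classical all_reals all_analysis.
From mathcomp Require Import lra ring.

Set Implicit Arguments.
Unset Strict Implicit.
Unset Printing Implicit Defensive.

Import Order.TTheory GRing.Theory Num.Theory.
Import numFieldNormedType.Exports.

Local Open Scope classical_set_scope.
Local Open Scope ring_scope.

(** * Quasi-tilings *)

Definition core (G : groupType) (K A : {fset G}) : {fset G} :=
  [fset t in A | (rtrans K t `<=` A)%fset]%fset.

Definition tiles (G : groupType) (T : {fset G}) (C : seq G) : {fset G} :=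
  (\big[fsetU/fset0]_(c <- C) rtrans T c)%fset.

Definition defect (G : groupType) (K A : {fset G}) : {fset G} :=
  (A `\` core K A)%fset.

Definition fsetV (G : groupType) (K : {fset G}) : {fset G} :=
  [fset k^-1%g | k in K]%fset.

(** Contains every point outside [T] that some [k] in [K] moves into [T]: the image lies in [T], and
    [k^-1] moves it out again. It is small once [T] is invariant under [K^-1]. *)
Definition outer (G : groupType) (K T : {fset G}) : {fset G} :=
  [fset (p.1 * p.2)%g | p in (fsetV K `*` defect (fsetV K) T)%fset]%fset.

Section Tiling.
Variable G : groupType.
Implicit Types (K T A U : {fset G}) (C : seq G) (c t u : G).

Lemma mem_rtrans K t u : (u \in rtrans K t) = ((u * t^-1)%g \in K).
Proof.
apply/imfsetP/idP => [[s sK ->]|uK]; first by rewrite mulgK.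
by exists (u * t^-1)%g => //; rewrite mulgVK.
Qed.

Lemma card_rtrans K t : #|` rtrans K t| = #|` K|.
Proof. by rewrite card_imfset //=; apply: mulIg. Qed.

Lemma mem_core K A t : (t \in core K A) = (t \in A) && (rtrans K t `<=` A)%fset.
Proof. by rewrite !inE. Qed.

Lemma core_sub K A : (core K A `<=` A)%fset.
Proof. by apply/fsubsetP => t; rewrite mem_core => /andP[]. Qed.

Lemma mem_defect K A t :
  (t \in defect K A) = (t \in A) && ~~ (rtrans K t `<=` A)%fset.
Proof. by rewrite in_fsetD mem_core; case: (t \in A) => //=; rewrite andbT. Qed.

Lemma card_core_defect K A : (#|` core K A| + #|` defect K A| = #|` A|)%N.
Proof.
rewrite -(cardfsID (core K A) A); congr (_ + _)%N.
by rewrite (fsetIidPr (core_sub K A)).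
Qed.

Lemma mem_fsetV K u : (u \in fsetV K) = (u^-1%g \in K).
Proof.
apply/imfsetP/idP => [[s sK ->]|uK]; first by rewrite invgK.
by exists u^-1%g => //; rewrite invgK.
Qed.

Lemma card_outer K T : (#|` outer K T| <= #|` K| * #|` defect (fsetV K) T|)%N.
Proof.
apply: (leq_trans (leq_imfset_card _ _ _)).
apply: (@leq_trans (size [seq (a, b) | a <- fsetV K, b <- defect (fsetV K) T])).
  apply: uniq_leq_size; first exact: fset_uniq.
  move=> [a b]; rewrite in_fsetM => /andP[aK bT].
  by apply/allpairsP; exists (a, b).
rewrite size_allpairs leq_mul2r; apply/orP; right.
exact: leq_imfset_card.
Qed.

Lemma tiles_cons T c C : tiles T (c :: C) = (rtrans T c `|` tiles T C)%fset.
Proof. by rewrite /tiles big_cons. Qed.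

Lemma tilesP T C u :
  reflect (exists2 c, c \in C & u \in rtrans T c) (u \in tiles T C).
Proof.
elim: C => [|c C IH].
  by rewrite /tiles big_nil in_fset0; constructor => -[].
rewrite tiles_cons in_fsetU; apply: (iffP orP).
  case=> [uc|/IH[d dC ud]]; first by exists c; rewrite ?mem_head.
  by exists d => //; rewrite in_cons dC orbT.
case=> d; rewrite in_cons => /orP[/eqP-> ud|dC ud]; first by left.
by right; apply/IH; exists d.
Qed.

Lemma card_tiles T C : (#|` tiles T C| <= size C * #|` T|)%N.
Proof.
elim: C => [|c C IH]; first by rewrite /tiles big_nil cardfs0.
rewrite tiles_cons mulSn (leq_trans (leq_card_fsetU _ _).1)//.
by rewrite card_rtrans leq_add2l.
Qed.

Lemma mem_outer K T c t k : k \in K -> (k * t)%g \in rtrans T c ->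
  t \notin rtrans T c -> t \in rtrans (outer K T) c.
Proof.
rewrite !mem_rtrans => kK ktT tT; apply/imfsetP.
exists ((k^-1)%g, (k * t * c^-1)%g) => /=; last by rewrite !mulgA mulVg mul1g.
rewrite in_fsetM /= mem_fsetV invgK kK mem_defect ktT /=.
apply/negP => /fsubsetP/(_ (t * c^-1)%g); rewrite mem_rtrans mem_fsetV.
have -> : (t * c^-1 * (k * t * c^-1)^-1)^-1%g = k.
  by rewrite invgM invgK -(mulgA k) mulgK.
by rewrite (negPf tT) => /(_ kK).
Qed.

(** A point outside the tiles becomes defective by their removal only if [K] moves it into some
    tile, which puts it in the outer boundary of that tile. *)
Lemma defect_fsetD_tiles K T A C :
  (defect K (A `\` tiles T C) `<=` defect K A `|` tiles (outer K T) C)%fset.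
Proof.
apply/fsubsetP => t; rewrite mem_defect in_fsetU mem_defect in_fsetD.
case/andP=> /andP[tU tA] /fsubsetPn[u]; rewrite tA /=.
move=> /imfsetP[k /= kK ->]; rewrite in_fsetD negb_and negbK => /orP[kU|kA].
- apply/orP; right; case/tilesP: kU => c cC ktc.
  apply/tilesP; exists c => //; apply: (mem_outer kK ktc).
  by apply: contra tU => tc; apply/tilesP; exists c.
- apply/orP; left; apply/fsubsetPn; exists (k * t)%g => //.
  by apply/imfsetP; exists k.
Qed.

Lemma count_fset (A B : {fset G}) :
  (\sum_(u <- A) (u \in B) = #|` (A `&` B)%fset|)%N.
Proof.
under eq_bigr => u _ do rewrite -[nat_of_bool _]/(if u \in B then 1 else 0)%N.
rewrite -big_mkcond sum1_count -size_filter.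
apply: perm_size; apply: uniq_perm; rewrite ?filter_uniq ?fset_uniq// => u.
by rewrite mem_filter in_fsetI andbC.
Qed.

(** A point [u] lies in the translate centred at [c] only when [c = t^-1 u] with [t] in [T], hence
    for at most |T| centres. *)
Lemma double_count T A U :
  (\sum_(c <- A) #|` (rtrans T c `&` U)%fset| <= #|` T| * #|` U|)%N.
Proof.
under eq_bigr => c _ do rewrite fsetIC -count_fset.
rewrite exchange_big /= mulnC (card_fset_sum1 U) big_distrl /=.
apply: leq_sum => u _; rewrite mul1n.
have H c : (u \in rtrans T c) =
  (c \in [fset (t^-1 * u)%g | t in T]%fset).
  rewrite mem_rtrans; apply/idP/imfsetP => [uT|[t tT ->]].
    by exists (u * c^-1)%g => //; rewrite invgM invgK mulgVK.
  by rewrite invgM invgK mulgA mulgV mul1g.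
under eq_bigr => c _ do rewrite H.
rewrite count_fset (leq_trans (fsubset_leq_card (fsubsetIr _ _)))//.
exact: leq_imfset_card.
Qed.

(** A centre is added when its translate is covered in proportion less than [e]. Each addition
    brings more than (1 - e)|T| new points, whence the almost disjointness in the second clause; the
    other centres satisfy the third, as coverage only grows. *)
Lemma greedy_tiles (R : realType) T (e : R) (s : seq G) : 0 <= e <= 1 ->
  exists C : seq G, [/\ {subset C <= s},
    (1 - e) * #|` T|%:R * (size C)%:R <= #|` tiles T C|%:R &
    forall c, c \in s -> e * #|` T|%:R <= #|` (rtrans T c `&` tiles T C)%fset|%:R].
Proof.
move=> /andP[e0 e1]; elim: s => [|c s [C [Cs Csz Cful]]].
  by exists [::]; split => //; rewrite mulr0.
have [full|notfull] :=
  lerP (e * #|` T|%:R) (#|` (rtrans T c `&` tiles T C)%fset|%:R).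
  exists C; split => // [d /Cs|d]; first by rewrite in_cons orbC => ->.
  by rewrite in_cons => /orP[/eqP-> //|/Cful].
exists (c :: C); split => [d| |d].
- by rewrite !in_cons => /orP[->//|/Cs ->]; rewrite orbT.
- have H1 := cardfsUI (rtrans T c) (tiles T C).
  rewrite card_rtrans in H1.
  move/(congr1 (fun n : nat => n%:R : R)): H1; rewrite !natrD => H1.
  rewrite tiles_cons /= -natr1; nra.
- rewrite in_cons tiles_cons => /orP[/eqP->|/Cful dful].
    rewrite fsetIUr fsetIid (fsetUidPl _ _ (fsubsetIl _ _)) card_rtrans.
    by rewrite ler_piMl.
  apply: (le_trans dful); rewrite ler_nat fsubset_leq_card// fsetIUr.
  exact: fsubsetUr.
Qed.

(* Stop filling [A] greedily once every translate of [T] inside [A] meets the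
   filled part in proportion at least [e]; double counting then shows that
   the filled part is a proportion [e] of the possible centres. *)
Lemma filling (R : realType) T A (e : R) : 0 <= e <= 1 -> T != fset0 ->
  exists C : seq G, [/\ (tiles T C `<=` A)%fset,
    (1 - e) * #|` T|%:R * (size C)%:R <= #|` tiles T C|%:R &
    e * #|` core T A|%:R <= #|` tiles T C|%:R].
Proof.
move=> e01 T0; have [C [CA Csz Cful]] := greedy_tiles T (core T A) e01.
exists C; split => //.
  apply/fsubsetP => u /tilesP[c /CA]; rewrite mem_core => /andP[_ /fsubsetP].
  exact.
have Tpos : (0 : R) < #|` T|%:R by rewrite ltr0n cardfs_gt0.
rewrite -(ler_pM2l Tpos) -[leRHS]natrM.
have := double_count T (core T A) (tiles T C).
rewrite -(ler_nat R) => /(le_trans _); apply.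
rewrite mulrA (card_fset_sum1 (core T A)) !natr_sum mulr_sumr !big_seq.
apply: ler_sum => c cA; rewrite mulr1 mulrC; exact: Cful.
Qed.

End Tiling.

(** * The Ornstein-Weiss theorem *)

Section Folner.
Variables (R : realType) (G : groupType).
Implicit Types (K T A F : {fset G}) (d : R).

Lemma defectS K K' A : (K `<=` K')%fset -> (defect K A `<=` defect K' A)%fset.
Proof.
move=> KK'; apply/fsubsetP => t; rewrite !mem_defect => /andP[-> /=].
apply: contra => /fsubsetP H; apply/fsubsetP => u; rewrite mem_rtrans => uK.
by apply: H; rewrite mem_rtrans (fsubsetP KK').
Qed.

Lemma invariantP K d F : invariant_fsets K d F <->
  F != fset0 /\ #|` defect K F|%:R <= d * #|` F|%:R.
Proof.
rewrite /invariant_fsets /= -/(core K F).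
have := congr1 (fun n : nat => n%:R : R) (card_core_defect K F).
by rewrite natrD => H; split=> -[F0 HF]; split=> //; lra.
Qed.

Lemma invariantS K K' d d' : (K `<=` K')%fset -> d' <= d ->
  invariant_fsets K' d' `<=` invariant_fsets K d.
Proof.
move=> KK' dd' F /invariantP[F0 HF]; apply/invariantP; split => //.
apply: (@le_trans _ _ #|` defect K' F|%:R).
  by rewrite ler_nat fsubset_leq_card// defectS.
by apply: (le_trans HF); rewrite ler_wpM2r.
Qed.

#[global] Instance amenable_filter_filter : Filter (@amenable_filter R G).
Proof.
apply: filter_from_filter.
  by exists ([fset 1%g]%fset, 1) => /=; split => //; rewrite -cardfs_gt0 cardfs1.
move=> [K d] [K' d'] /= [K0 d0] [K'0 d'0].
exists ((K `|` K')%fset, Num.min d d') => /=.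
  split; last by rewrite lt_min d0.
  by apply: contra K0 => /eqP E; rewrite -fsubset0 -E fsubsetUl.
move=> F HF; split.
  by apply: (invariantS _ _ HF); rewrite ?fsubsetUl ?ge_min ?lexx.
by apply: (invariantS _ _ HF); rewrite ?fsubsetUr ?ge_min ?lexx ?orbT.
Qed.

(** A defective [t] has some [s] in [K] with [s t] outside [F]; for fixed [s], left translation by
    [s] sends such points injectively into [s F] minus [F]. *)
Lemma card_defect_symdiff K F :
  (#|` defect K F| <= \sum_(s <- K) #|` symdiff (ltrans s F) F|)%N.
Proof.
apply: (@leq_trans (\sum_(s <- K) #|` (F `\` ltrans s^-1%g F)%fset|)%N).
  apply: (@leq_trans (\sum_(s <- K) \sum_(t <- defect K F)
      (t \in F `\` ltrans s^-1%g F)%fset)%N).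
    rewrite exchange_big /= card_fset_sum1 big_seq [leqRHS]big_seq.
    apply: leq_sum => t; rewrite mem_defect => /andP[tF /fsubsetPn[u]].
    case/imfsetP => s /= sK -> stF.
    rewrite (big_rem s) //= in_fsetD tF andbT (_ : _ \notin _) ?leq_addr//.
    apply: contra stF => /imfsetP[v /= vF ->].
    by rewrite mulgA mulgV mul1g.
  apply: leq_sum => s _; rewrite count_fset.
  by rewrite fsubset_leq_card// fsubsetIr.
apply: leq_sum => s _.
have inj : injective (fun t : G => (s * t)%g) by exact: mulgI.
apply: (@leq_trans #|` ltrans s (F `\` ltrans s^-1%g F)%fset|).
  by rewrite [leqRHS]card_imfset /=.
apply: fsubset_leq_card; apply/fsubsetP => u /imfsetP[t /=].
rewrite in_fsetD => /andP[tF' tF] ->; rewrite in_fsetU !in_fsetD.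
apply/orP; left; apply/andP; split; last by apply/imfsetP; exists t.
apply: contra tF' => stF; apply/imfsetP; exists (s * t)%g => //.
by rewrite mulgA mulVg mul1g.
Qed.

Lemma folner_invariant (F : nat -> {fset G}) K d : folner_sequence R F ->
  0 < d -> \forall n \near \oo, invariant_fsets K d (F n).
Proof.
move=> [F0 Fcvg] d0.
(* The tolerance stays universally quantified, since the induction over the list halves it at each
   element. *)
have key (s : seq G) (e : R) : 0 < e -> \forall n \near \oo,
    (\sum_(t <- s) #|` symdiff (ltrans t (F n)) (F n)|)%N%:R <= e * #|` F n|%:R.
  elim: s e => [|t s IH] e e0.
    by apply: nearW => n; rewrite big_nil mulr_ge0// ltW.
  have e20 : 0 < e / 2 by lra.
  have /cvgrPdist_lt/(_ _ e20) := Fcvg t.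
  apply: filterS2 (IH _ e20) => n IHn.
  rewrite sub0r normrN ger0_norm ?divr_ge0// ltr_pdivrMr; last first.
    by rewrite ltr0n cardfs_gt0.
  by rewrite big_cons natrD => H; lra.
apply: filterS (key K d d0) => n H; apply/invariantP; split => //.
by apply: le_trans H; rewrite ler_nat card_defect_symdiff.
Qed.

Lemma amenable_filter_proper : amenable R G ->
  ProperFilter (@amenable_filter R G).
Proof.
move=> [F folF]; apply: filter_from_proper => -[K d] /= [_ d0].
have [n _ Hn] := folner_invariant K folF d0.
by exists (F n); apply: Hn => /=.
Qed.

Lemma folner_cvg (F : nat -> {fset G}) : folner_sequence R F ->
  F @ \oo --> @amenable_filter R G.
Proof.
move=> folF P [[K d] /= [_ d0] KdP].
by apply: filterS (folner_invariant K folF d0) => n /KdP.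
Qed.

End Folner.

(** * Limits of subadditive invariant functions *)

Section OrnsteinWeiss.
Variables (R : realType) (G : groupType) (h : {fset G} -> R).
Hypothesis h_ge0 : forall A, 0 <= h A.
Hypothesis h_fset0 : h fset0 <= 0.
Hypothesis h_fsetU : forall A B, h (A `|` B)%fset <= h A + h B.
Hypothesis h_rtrans : forall A c, h (rtrans A c) <= h A.
Implicit Types (K T A F : {fset G}) (d : R).

Let h1 := h [fset 1%g]%fset.

Lemma h_tiles T C : h (tiles T C) <= h T * (size C)%:R.
Proof.
elim: C => [|c C IH]; first by rewrite /tiles big_nil mulr0.
rewrite tiles_cons (le_trans (h_fsetU _ _))// -natr1 mulrDr mulr1 addrC.
by rewrite lerD.
Qed.

Lemma h_card A : h A <= h1 * #|` A|%:R.
Proof.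
have E : A = tiles [fset 1%g]%fset (enum_fset A).
  apply/fsetP => u; apply/idP/tilesP => [uA|[c cA]].
    by exists u => //; rewrite mem_rtrans mulgV in_fset1.
  by rewrite mem_rtrans in_fset1 mulg_eq1 invgK => /eqP ->.
by rewrite {1}E; apply: h_tiles.
Qed.

(* [A] is the part of a set of size [N] that is still uncovered, so its
   invariance is measured relative to [N], not to its own size. *)
Lemma quasi_tiling (mu e del : R) (k : nat) : 0 <= mu -> 0 < e < 1 -> 0 < del ->
  (forall K d, 0 < d ->
    exists2 T, invariant_fsets K d T & h T <= (1 - e) * mu * #|` T|%:R) ->
  exists K d, [/\ K != fset0, 0 < d & forall A (N : R),
    #|` A|%:R <= N -> #|` defect K A|%:R <= d * N ->
    h A <= mu * #|` A|%:R
           + h1 * ((1 - e) ^+ k * (#|` A|%:R - del * N) + del * N)].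
Proof.
move=> mu0 /andP[e0 e1] del0 good; have h10 : 0 <= h1 by exact: h_ge0.
elim: k => [|k [K [d [K0 d0 IH]]]].
  exists [fset 1%g]%fset, 1; split => //; first by rewrite -cardfs_gt0 cardfs1.
  move=> A N AN _; rewrite expr0 mul1r subrK (le_trans (h_card A))// lerDr.
  by rewrite mulr_ge0.
have cK0 : (0 : R) < #|` K|%:R by rewrite ltr0n cardfs_gt0.
(* The tolerance is calibrated so that, by the almost disjointness of the tiles, their outer
   boundaries together take at most half of the defect budget [d * N]. *)
have [|T /invariantP[T0 Tinv] hT] := good (fsetV K) (d * (1 - e) / 2 / #|` K|%:R).
  by rewrite !divr_gt0// mulr_gt0// subr_gt0.
have outT : #|` outer K T|%:R <= d / 2 * ((1 - e) * #|` T|%:R) :> R.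
  have := card_outer K T; rewrite -(ler_nat R) natrM => /le_trans; apply.
  rewrite mulrC -ler_pdivlMr// (le_trans Tinv)// le_eqVlt; apply/orP; left.
  by apply/eqP; ring.
(* Half of the defect budget is reserved for [A] itself, half for the holes left by the tiles; the
   bound [del] makes all but [del * N] points of [A] admissible centres for [T]. *)
exists (K `|` T)%fset, (Num.min (d / 2) del); split.
- by apply: contra K0 => /eqP E; rewrite -fsubset0 -E fsubsetUl.
- by rewrite lt_min del0 divr_gt0.
move=> A N AN HA.
have N0 : 0 <= N by apply: le_trans AN.
have AK : #|` defect K A|%:R <= d / 2 * N.
  apply: (@le_trans _ _ #|` defect (K `|` T)%fset A|%:R).
    by rewrite ler_nat fsubset_leq_card// defectS// fsubsetUl.
  by apply: (le_trans HA); rewrite ler_wpM2r// ge_min lexx.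
have AT : #|` defect T A|%:R <= del * N.
  apply: (@le_trans _ _ #|` defect (K `|` T)%fset A|%:R).
    by rewrite ler_nat fsubset_leq_card// defectS// fsubsetUr.
  by apply: (le_trans HA); rewrite ler_wpM2r// ge_min lexx orbT.
have [|C [UA UC UT]] := @filling _ R T A e _ T0; first by rewrite !ltW.
set U := tiles T C in UA UC UT *.
have cA : #|` (A `\` U)%fset|%:R = #|` A|%:R - #|` U|%:R :> R.
  by rewrite cardfsDS// natrB// fsubset_leq_card.
have cT : #|` core T A|%:R = #|` A|%:R - #|` defect T A|%:R :> R.
  by rewrite -(card_core_defect T A) natrD addrK.
have dAU : #|` defect K (A `\` U)%fset|%:R <= d * N.
  have := fsubset_leq_card (defect_fsetD_tiles K T A C).
  rewrite -(ler_nat R) => /le_trans; apply.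
  apply: (@le_trans _ _ (#|` defect K A|%:R
      + (size C)%:R * #|` outer K T|%:R)).
    rewrite -natrM -natrD ler_nat.
    by rewrite (leq_trans (leq_card_fsetU _ _).1)// leq_add2l card_tiles.
  have s0 : (0 : R) <= (size C)%:R by [].
  have UN : #|` U|%:R <= N.
    by apply: le_trans AN; rewrite ler_nat fsubset_leq_card.
  apply: (@le_trans _ _ (d / 2 * N + d / 2 * #|` U|%:R)); last first.
    by rewrite -mulrDr; nra.
  apply: lerD => //; apply: (le_trans (ler_wpM2l s0 outT)).
  rewrite mulrC -(mulrA (d / 2)).
  by rewrite ler_wpM2l// divr_ge0// ltW.
have AUN : #|` (A `\` U)%fset|%:R <= N.
  by rewrite cA; apply: le_trans AN; rewrite gerBl.
have {}IH := IH _ _ AUN dAU.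
(* The factor [1 - e] in the bound on [h T] pays for the overlaps of the tiles. *)
have hU : h U <= mu * #|` U|%:R.
  apply: (le_trans (h_tiles _ _)).
  apply: (le_trans (ler_wpM2r _ hT)) => //.
  rewrite (mulrC (1 - e)) -!mulrA (mulrA (1 - e)).
  by rewrite ler_wpM2l.
have hA : h A <= h U + h (A `\` U)%fset.
  by have := h_fsetU U (A `\` U)%fset;
     rewrite fsetUDl fsetDv fsetD0 (fsetUidPr _ _ UA).
apply: (le_trans hA); apply: (le_trans (lerD hU IH)).
rewrite addrA cA -mulrDr (addrC #|` U|%:R) subrK lerD2l.
rewrite ler_wpM2l// lerD2r exprSr -mulrA.
(* The filling covers at least [e * (|A| - del * N)] points, so the excess over [del * N] shrinks by
   the factor [1 - e]. *)
have : 0 <= 1 - e by lra.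
move=> /(exprn_ge0 k) /ler_wpM2l; apply; rewrite cT in UT; nra.
Qed.

Lemma ornstein_weiss_upper (c eps : R) : 0 < eps -> 0 <= c ->
  (forall K d, 0 < d ->
    exists2 T, invariant_fsets K d T & h T <= c * #|` T|%:R) ->
  \forall F \near @amenable_filter R G, h F / #|` F|%:R <= c + eps.
Proof.
move=> eps0 c0 good; have h10 : 0 <= h1 by exact: h_ge0.
(* As [e * (mu + 1) = eps / 2], one has [c <= (1 - e) * mu]. After enough steps the uncovered part
   costs at most [2 * h1 * del <= eps / 2] per point of [F]. Adding 1 in the denominators gives
   [e < 1] and allows [h1 = 0]. *)
pose mu := c + eps / 2; pose e := eps / 2 / (mu + 1).
pose del := eps / 4 / (h1 + 1).
have mu0 : 0 <= mu by rewrite /mu; lra.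
have mu10 : 0 < mu + 1 by lra.
have e0 : 0 < e by rewrite !divr_gt0.
have e1 : e < 1 by rewrite ltr_pdivrMr// mul1r /mu; lra.
have del0 : 0 < del by rewrite !divr_gt0// ltr_wpDl.
have [k kdel] : exists k, (1 - e) ^+ k <= del.
  have /cvgrPdist_lt/(_ _ del0)[k _ /(_ k (leqnn k))] :
      (fun k => (1 - e) ^+ k) @ \oo --> (0 : R).
    by apply: cvg_expr; rewrite ger0_norm; lra.
  rewrite sub0r normrN ger0_norm ?exprn_ge0 ?subr_ge0 1?ltW// => /ltW ?.
  by exists k.
have e01 : 0 < e < 1 by rewrite e0.
have mu_good K d : 0 < d ->
    exists2 T, invariant_fsets K d T & h T <= (1 - e) * mu * #|` T|%:R.
  move=> d0; have [T TKd hT] := good K d d0; exists T => //.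
  apply: (le_trans hT); rewrite ler_wpM2r//.
  have : e * (mu + 1) = eps / 2 by rewrite /e divfK// gt_eqF.
  by rewrite /mu in e0 mu0 *; nra.
have [K [d [K0 d0 HK]]] := quasi_tiling k mu0 e01 del0 mu_good.
exists (K, d) => // F /invariantP[F0 HF].
have F_gt0 : (0 : R) < #|` F|%:R by rewrite ltr0n cardfs_gt0.
rewrite /= ler_pdivrMr//; apply: (le_trans (HK F _ (lexx _) HF)).
have E : del * (h1 + 1) = eps / 4 by rewrite /del divfK// gt_eqF// ltr_wpDl.
have -> : #|` F|%:R - del * #|` F|%:R = (1 - del) * #|` F|%:R by ring.
rewrite mulrA -mulrDl (mulrA h1) -mulrDl ler_wpM2r// /mu -addrA lerD2l.
have X : (1 - e) ^+ k * (1 - del) <= del.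
  by apply: le_trans kdel; rewrite ler_piMr ?exprn_ge0//; lra.
have := ler_wpM2l h10 X; lra.
Qed.

Lemma ornstein_weiss : amenable R G ->
  cvg (h F / #|` F|%:R @[F --> @amenable_filter R G]).
Proof.
move=> /amenable_filter_proper PF; have h10 : 0 <= h1 by exact: h_ge0.
(* The infimum of [S] is the lower limit of [h F / |F|] along the filter, hence the candidate
   limit. *)
pose S := [set c : R | 0 <= c /\ forall K d, 0 < d ->
    exists2 T, invariant_fsets K d T & h T <= c * #|` T|%:R].
have lbS : lbound S 0 by move=> c [].
have inv_near K d : 0 < d -> \forall F \near @amenable_filter R G,
   invariant_fsets K d F.
  move=> d0; exists ((1%g |` K)%fset, d) => /=.
    by split=> //; apply/fset0Pn; exists 1%g; rewrite in_fset1U eqxx.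
  by apply: invariantS; rewrite ?fsubsetU1.
have S0 : S !=set0.
  exists h1; split => // K d d0; have [T TKd] := filter_ex (inv_near K d d0).
  by exists T => //; apply: h_card.
apply/cvg_ex; exists (inf S); apply/cvgrPdist_le => /= eps eps0.
have eps20 : 0 < eps / 2 by rewrite divr_gt0.
have [c [c0 cS] clt] : exists2 c, S c & c < inf S + eps / 2.
  by apply: inf_adherent => //; split => //; exists 0.
have up := ornstein_weiss_upper eps20 c0 cS.
have low : \forall F \near @amenable_filter R G, inf S - eps <= h F / #|` F|%:R.
  (* A negative value is outside [S] by its first clause alone, which says nothing about [h]; this
     case is settled by [h_ge0]. *)
  have [neg|pos] := ltrP (inf S - eps) 0.
    by apply: nearW => F; apply: (le_trans (ltW neg)); rewrite divr_ge0.
  have nS : ~ S (inf S - eps).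
    by move=> /ge_inf => /(_ (ex_intro _ 0 lbS)); lra.
  apply: contrapT => nlow; apply: nS; split => // K d d0.
  apply: contrapT => nT; apply: nlow.
  apply: filterS (inv_near K d d0) => F KdF.
  have F_gt0 : (0 : R) < #|` F|%:R by case: KdF; rewrite ltr0n cardfs_gt0.
  rewrite ler_pdivlMr// leNgt; apply/negP => /ltW hF; apply: nT.
  by exists F.
apply: filterS2 up low => F up low; rewrite ler_norml; apply/andP; split; lra.
Qed.

End OrnsteinWeiss.

(** * Common refinements of open covers *)

Section OpenCozero.
Variables (R : realType) (X : topologicalType).

(* The distance to the complement, capped at 1 because the complement may be
   empty. *)
Lemma metrizable_open_cozero (U : set X) : metrizable R X -> open U ->
  exists f : X -> R, [/\ continuous f, forall x, 0 <= f x &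
    forall x, 0 < f x <-> U x].
Proof.
move=> [d [d0 dC dtri dnbhs]] oU.
have dge0 x y : 0 <= d x y.
  by have := dtri x y x; rewrite (dC y x) (d0 x x).2//; lra.
pose E x := [set d x z | z in ~` U] `|` [set 1 : R].
pose f x := inf (E x).
have E0 x : E x !=set0 by exists 1; right.
have lbE x : has_lbound (E x).
  by exists 0 => r [[z _ <-]|->].
have f_lip x y : f x <= f y + d x y.
  rewrite -lerBlDr; apply: lb_le_inf => // r [[z Uz <-]|->].
    rewrite lerBlDr addrC; apply: le_trans (dtri x y z).
    by apply: ge_inf => //; left; exists z.
  have : f x <= 1 by apply: ge_inf => //; right.
  by have := dge0 x y; lra.
exists f; split=> [x|x|x].
- apply/cvgrPdist_lt => /= e e0.
  apply/dnbhs; exists e => // y /= dxy.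
  have := f_lip x y; have := f_lip y x; rewrite (dC y x) ltr_norml => *.
  by apply/andP; split; lra.
- by apply: lb_le_inf => // r [[z _ <-]|->].
- split=> [fx|Ux].
    apply: contrapT => nUx; move: fx; apply/negP; rewrite -leNgt.
    by apply: ge_inf => //; left; exists x => //; apply/d0.
  have /dnbhs[e e0 eU] : nbhs x U by apply: open_nbhs_nbhs.
  apply: (@lt_le_trans _ _ (Num.min e 1)); first by rewrite lt_min e0 ltr01.
  apply: lb_le_inf => // r [[z Uz <-]|->]; last by rewrite ge_min lexx orbT.
  by rewrite ge_min leNgt; apply/orP; left; apply/negP => /eU.
Qed.

Lemma open_lt_continuous (f g : X -> R) : continuous f -> continuous g ->
  open [set x | f x < g x].
Proof.
move=> cf cg; have -> : [set x | f x < g x] = (g \- f) @^-1` [set r | 0 < r].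
  by apply/seteqP; split=> x /=; rewrite subr_gt0.
apply: open_comp; last exact: open_gt.
by move=> x _; apply: continuousB; [exact: cg|exact: cf].
Qed.

Lemma continuous_sum (I : Type) (r : seq I) (P : pred I) (f : I -> X -> R) :
  (forall i, continuous (f i)) -> continuous (fun x => \sum_(i <- r | P i) f i x).
Proof.
by move=> cf; apply: continuous_big => // -[u v]; exact: add_continuous.
Qed.

End OpenCozero.

(** * Overlaps of two subdivisions of a segment *)

Section Staircase.
Variable R : realType.
Implicit Types S T : nat -> R.

(* The intervals ]S i, S i.+1[ and ]T j, T j.+1[ are nonempty and meet. *)
Definition overlap S T i j :=
  [&& S i < S i.+1, T j < T j.+1, S i < T j.+1 & T j < S i.+1].

Lemma first_step S m : S 0%N = 0 -> 0 < S m ->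
  exists2 i : 'I_m, S i <= 0 & 0 < S i.+1.
Proof.
move=> S0; elim: m => [|m IH] Sm; first by rewrite S0 ltxx in Sm.
have [/IH[i Si0 Si]|Sm0] := ltP 0 (S m).
  by exists (widen_ord (leqnSn m) i).
by exists ord_max.
Qed.

(** Each subdivision has an interval reaching from at most 0 to beyond 0, and two such intervals
    meet. *)
Lemma overlap_ex S T m n : S 0%N = 0 -> T 0%N = 0 -> 0 < S m -> 0 < T n ->
  exists (i : 'I_m) (j : 'I_n), overlap S T i j.
Proof.
move=> S0 T0 /(first_step S0)[i Si Si1] /(first_step T0)[j Tj Tj1].
exists i, j; apply/and4P; split; lra.
Qed.

Lemma step_unique S (s : R) i j : {homo S : i j / (i <= j)%N >-> i <= j} ->
  S i <= s < S i.+1 -> S j <= s < S j.+1 -> i = j.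
Proof.
move=> mS /andP[i1 i2] /andP[j1 j2]; have [ij|ji|//] := ltngtP i j.
  by exfalso; have := mS _ _ ij; lra.
by exfalso; have := mS _ _ ji; lra.
Qed.

(* Each overlap of two intervals starts at the left end of one of them, which
   determines the other one; the first interval of the second subdivision
   never starts strictly inside an interval of the first one. *)
Lemma card_overlap S T m n : {homo S : i j / (i <= j)%N >-> i <= j} ->
  {homo T : i j / (i <= j)%N >-> i <= j} -> S 0%N = 0 -> T 0%N = 0 -> 0 < T n ->
  (#|[set p : 'I_m * 'I_n | overlap S T p.1 p.2]%SET| <
   #|[set i : 'I_m | (S i < S i.+1)%R]%SET| +
   #|[set j : 'I_n | (T j < T j.+1)%R]%SET|)%N.
Proof.
move=> mS mT S0 T0 Tn.
have [j0 Tj0 Tj01] := first_step T0 Tn.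
set Q := [set p | _]%SET; set I := [set i | _]%SET; set J := [set j | _]%SET.
have j0J : j0 \in J by rewrite inE (le_lt_trans Tj0).
(* In [B] the overlap starts at the left end of the first interval, ties included. Off [B] the
   second interval starts after a nonnegative point, so it is not [j0]; this makes the final
   inequality strict. *)
pose B := [set p : 'I_m * 'I_n | T p.2 <= S p.1]%SET.
rewrite -(cardsID B Q) (cardsD1 j0 J) j0J addnCA add1n ltnS leq_add//.
- rewrite -(card_in_imset (f := fst) (D := Q :&: B)%SET).
    apply/subset_leq_card/fintype.subsetP => i /imsetP[[i' j]].
    by rewrite !inE => /andP[/and4P[]] /= ? _ _ _ _ ->.
  move=> [i j] [i' j']; rewrite !inE /=.
  move=> /andP[/and4P[_ _ a1 _] a2] /andP[/and4P[_ _ b1 _] b2] E.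
  subst i'; congr (_, _); apply/val_inj.
  by apply: (step_unique mT (s := S i)); apply/andP.
- rewrite -(card_in_imset (f := snd) (D := Q :\: B)%SET).
    apply/subset_leq_card/fintype.subsetP => j /imsetP[[i j']].
    rewrite !inE /= -ltNge => /andP[a /and4P[_ c _ _]] ->; rewrite c andbT.
    apply/eqP => E; have := mS _ _ (leq0n i); rewrite S0; move: a.
    by rewrite E; lra.
  move=> [i j] [i' j']; rewrite !inE /= -!ltNge.
  move=> /andP[a1 /and4P[_ _ _ a2]] /andP[b1 /and4P[_ _ _ b2]] E.
  subst j'; congr (_, _); apply/val_inj.
  by apply: (step_unique mS (s := T j)); apply/andP; split => //; apply: ltW.
Qed.

End Staircase.

(** * Orders of covers *)

Section CoverOrd.
Variables (R : realType) (X : topologicalType).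
Implicit Types (A : set X) (W U V : set (set X)) (x : X).

Lemma open_coverTP W : finite_open_cover [set: X] W <->
  [/\ finite_set W, forall w, W w -> open w & cover W id = [set: X]].
Proof.
split=> -[finW oW cW]; split => //.
  case: oW => g og gE w Ww; have := gE w Ww; rewrite setTI /= => ->.
  exact: og.
by exists id => // w _; rewrite setTI.
Qed.

Lemma cover_ex W x : cover W id = [set: X] -> exists2 w, W w & w x.
Proof. by move=> cW; have : [set: X] x by []; rewrite -cW => -[w]; exists w. Qed.

Lemma mem_multiplicity W x w : finite_set W ->
  (w \in fset_set [set U | W U /\ U x]) = `[< W w /\ w x >].
Proof.
move=> finW; rewrite in_fset_set; last by apply: sub_finite_set finW => U [].
by apply/idP/asboolP; rewrite inE.
Qed.

Lemma multiplicity_gt0 W x w : finite_set W -> W w -> w x ->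
  (0 < multiplicity W x)%N.
Proof.
move=> finW Ww wx; rewrite cardfs_gt0; apply/fset0Pn; exists w.
by rewrite mem_multiplicity//; apply/asboolP.
Qed.

Lemma multiplicity_image (f : set X -> set X) W x x' : finite_set W ->
  (forall w, W w -> f w x' -> w x) ->
  (multiplicity [set f w | w in W] x' <= multiplicity W x)%N.
Proof.
move=> finW fW.
apply: (@leq_trans #|` [fset f w | w in fset_set [set U | W U /\ U x]]%fset|).
  apply/fsubset_leq_card/fsubsetP => u.
  rewrite mem_multiplicity; last exact: finite_image.
  move=> /asboolP[[w Ww <-] fwx]; apply/imfsetP; exists w => //=.
  by rewrite mem_multiplicity//; apply/asboolP; split => //; exact: fW.
exact: leq_imfset_card.
Qed.

Lemma multiplicity_has_ubound A W : finite_set W ->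
  has_ubound [set ((multiplicity W x)%:R : R) | x in A].
Proof.
move=> finW; exists #|` fset_set W|%:R => r [x _ <-]; rewrite ler_nat.
apply/fsubset_leq_card/fsubsetP => w; rewrite mem_multiplicity//.
by move=> /asboolP[Ww _]; rewrite in_fset_set// inE.
Qed.

Lemma multiplicity_le_ord A W x : finite_set W -> A x ->
  (multiplicity W x)%:R <= cover_ord R A W + 1.
Proof.
move=> finW Ax; rewrite /cover_ord subrK; apply: ub_le_sup; last by exists x.
exact: multiplicity_has_ubound.
Qed.

Lemma cover_ord_le A W (c : R) : A !=set0 ->
  (forall x, A x -> (multiplicity W x)%:R <= c + 1) -> cover_ord R A W <= c.
Proof.
move=> [x Ax] Wc; rewrite lerBlDr; apply: ge_sup.
  by exists (multiplicity W x)%:R, x.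
by move=> r [z Az <-]; exact: Wc.
Qed.

Lemma cover_ord_ge0 A W : A !=set0 -> finite_open_cover A W ->
  0 <= cover_ord R A W.
Proof.
move=> [x Ax] [finW _ cW]; have : cover W id x by rewrite cW.
move=> [w Ww wx].
have := multiplicity_le_ord finW Ax.
have : (1 : R) <= (multiplicity W x)%:R.
  by rewrite ler1n; exact: multiplicity_gt0 wx.
lra.
Qed.

Lemma open_cover_join U V : finite_open_cover [set: X] U ->
  finite_open_cover [set: X] V -> finite_open_cover [set: X] (cover_join U V).
Proof.
move=> /open_coverTP[fU oU cU] /open_coverTP[fV oV cV]; apply/open_coverTP; split.
- exact: finite_image2.
- by move=> _ [u Uu [v Vv <-]]; apply: openI; [exact: oU|exact: oV].
- apply/seteqP; split=> // x _.
  have [u Uu ux] := cover_ex x cU; have [v Vv vx] := cover_ex x cV.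
  by exists (u `&` v) => //; exists u => //; exists v.
Qed.

Lemma open_cover_preimage (f : X -> X) U : continuous f ->
  finite_open_cover [set: X] U ->
  finite_open_cover [set: X] [set f @^-1` u | u in U].
Proof.
move=> cf /open_coverTP[fU oU cU]; apply/open_coverTP; split.
- exact: finite_image.
- by move=> _ [u Uu <-]; apply: open_comp; [move=> x _; exact: cf|exact: oU].
- apply/seteqP; split=> // x _; have [u Uu ux] := cover_ex (f x) cU.
  by exists (f @^-1` u) => //; exists u.
Qed.

Lemma open_cover_setT : finite_open_cover [set: X] [set setT].
Proof.
apply/open_coverTP; split => //; first by move=> _ ->; exact: openT.
by apply/seteqP; split=> // x _; exists setT.
Qed.

(* Subdivide a segment proportionally to functions with cozero sets in [W1],
   and again proportionally to functions with cozero sets in [W2]: the pairs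
   of pieces that meet index the refinement. *)
Lemma join_refinement W1 W2 : metrizable R X ->
  finite_open_cover [set: X] W1 -> finite_open_cover [set: X] W2 ->
  exists W, [/\ finite_open_cover [set: X] W,
    refines W (cover_join W1 W2) &
    forall x, (multiplicity W x < multiplicity W1 x + multiplicity W2 x)%N].
Proof.
move=> mX /open_coverTP[fin1 o1 c1] /open_coverTP[fin2 o2 c2].
have [phi phiP] : {phi : set X -> X -> R & forall u : set X, open u ->
    [/\ continuous (phi u), forall x, 0 <= phi u x & forall x, 0 < phi u x <-> u x]}.
  apply: (@choice _ _ (fun (u : set X) (f : X -> R) => open u -> [/\ continuous f,
     forall x, 0 <= f x & forall x, 0 < f x <-> u x])) => u.
  have [oU|noU] := pselect (open u); last by exists (fun=> 0).
  by have [f fP] := metrizable_open_cozero mX oU; exists f.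
(* Enumerating without repetition bounds the number of functions positive at [x] by the
   multiplicity. Beyond the end of the list the default [set0] is open, so every index carries a
   valid function. *)
have enumP W : finite_set W -> (forall w, W w -> open w) ->
    cover W id = [set: X] -> exists (m : nat) (w : nat -> set X) (f : nat -> X -> R),
    [/\ forall i : 'I_m, W (w i),
        forall x, (#|[set i : 'I_m | (0 < f i x)%R]%SET| <= multiplicity W x)%N,
        forall i x, 0 < f i x -> w i x,
        (forall i, continuous (f i)) /\ (forall i x, 0 <= f i x) &
        forall x, 0 < \sum_(i < m) f i x].
  move=> finW oW cW; pose s := enum_fset (fset_set W).
  have mem_s w : (w \in s) = `[< W w >].
    by rewrite in_fset_set//; apply/idP/asboolP; rewrite inE.
  have op i : open (nth set0 s i).
    have [si|si] := ltnP i (size s); last by rewrite nth_default//; exact: open0.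
    by apply: oW; apply/asboolP; rewrite -mem_s mem_nth.
  exists (size s), (nth set0 s), (fun i => phi (nth set0 s i)); split.
  - by move=> i; apply/asboolP; rewrite -mem_s mem_nth.
  - move=> x; rewrite cardE.
    rewrite -(size_map (fun i : 'I_(size s) => nth set0 s i)).
    apply: uniq_leq_size.
      rewrite map_inj_uniq ?enum_uniq// => i j /eqP.
      by rewrite nth_uniq ?fset_uniq// => /eqP/val_inj.
    move=> w /mapP[i]; rewrite mem_enum inE => fi ->.
    rewrite mem_multiplicity//; apply/asboolP; split.
      by apply/asboolP; rewrite -mem_s mem_nth.
    by have [_ _ /(_ x)[+ _]] := phiP _ (op i); apply.
  - by move=> i x; case: (phiP _ (op i)) => _ _ /(_ x)[].
  - by split=> i; case: (phiP _ (op i)).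
  - move=> x; have [w Ww wx] := cover_ex x cW.
    have iw : (index w s < size s)%N.
      by rewrite index_mem mem_s; apply/asboolP.
    rewrite (bigD1 (Ordinal iw))//= ltr_pwDl//.
      have [_ _] := phiP _ (op (index w s)); move=> /(_ x)[_]; apply.
      by rewrite nth_index// mem_s; apply/asboolP.
    by apply: sumr_ge0 => i _; case: (phiP _ (op i)).
have [m [w1 [f [W1w cardf fw [cf f0] fpos]]]] := enumP _ fin1 o1 c1.
have [n [w2 [g [W2w cardg gw [cg g0] gpos]]]] := enumP _ fin2 o2 c2.
pose F x := \sum_(i < m) f i x; pose G x := \sum_(j < n) g j x.
pose S x i := \sum_(k < i) f k x * G x.
pose T x j := \sum_(k < j) g k x * F x.
have SS x i : S x i.+1 = S x i + f i x * G x by rewrite /S big_ord_recr.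
have TS x j : T x j.+1 = T x j + g j x * F x by rewrite /T big_ord_recr.
have mS x : {homo S x : i j / (i <= j)%N >-> i <= j}.
  apply/nondecreasing_seqP => i; rewrite SS lerDl.
  by rewrite mulr_ge0// ltW// gpos.
have mT x : {homo T x : i j / (i <= j)%N >-> i <= j}.
  apply/nondecreasing_seqP => j; rewrite TS lerDl.
  by rewrite mulr_ge0// ltW// fpos.
have S0 x : S x 0%N = 0 by rewrite /S big_ord0.
have T0 x : T x 0%N = 0 by rewrite /T big_ord0.
have Sm x : S x m = F x * G x by rewrite /S -mulr_suml.
have Tn x : T x n = F x * G x by rewrite /T -mulr_suml mulrC.
have FG x : 0 < F x * G x by apply: mulr_gt0; [exact: fpos|exact: gpos].
have cF : continuous F by exact: continuous_sum.
have cG : continuous G by exact: continuous_sum.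
have cS i : continuous (S^~ i).
  apply: continuous_sum => k x; apply: continuousM; [exact: cf|exact: cG].
have cT j : continuous (T^~ j).
  apply: continuous_sum => k x; apply: continuousM; [exact: cg|exact: cF].
have Sstep x i : (S x i < S x i.+1) = (0 < f i x).
  by rewrite SS ltrDl pmulr_lgt0//; exact: gpos.
have Tstep x j : (T x j < T x j.+1) = (0 < g j x).
  by rewrite TS ltrDl pmulr_lgt0//; exact: fpos.
pose O (p : 'I_m * 'I_n) := [set x | overlap (S x) (T x) p.1 p.2].
exists [set O p | p in [set: 'I_m * 'I_n]]; split.
- apply/open_coverTP; split.
  + by apply: finite_image; exact: finite_finset.
  + move=> _ [p _ <-].
    have -> : O p = [set x | S x p.1 < S x p.1.+1] `&`
        ([set x | T x p.2 < T x p.2.+1] `&` ([set x | S x p.1 < T x p.2.+1] `&`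
         [set x | T x p.2 < S x p.1.+1])).
      apply/seteqP; split=> [x /and4P[]//|x /= [? [? [? ?]]]].
      exact/and4P.
    by do 3?apply: openI; apply: open_lt_continuous.
  + apply/seteqP; split=> // x _.
    have [||i [j ij]] := @overlap_ex R (S x) (T x) m n (S0 x) (T0 x).
    * by rewrite Sm.
    * by rewrite Tn.
    by exists (O (i, j)) => //; exists (i, j).
- move=> _ [[i j] _ <-]; exists (w1 i `&` w2 j).
    by exists (w1 i) => //; exists (w2 j).
  by move=> x /and4P[/=]; rewrite Sstep Tstep => /fw ? /gw ?.
- move=> x; have := card_overlap m (mS x) (mT x) (S0 x) (T0 x) (n := n).
  rewrite Tn => /(_ (FG x)) card_lt.
  apply: (@leq_trans (#|[set i : 'I_m | (0 < f i x)%R]%SET| +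
      #|[set j : 'I_n | (0 < g j x)%R]%SET|)%N); last by rewrite leq_add.
  rewrite (eq_card (B := [set i : 'I_m | (S x i < S x i.+1)%R]%SET)); last first.
    by move=> i; rewrite !inE Sstep.
  rewrite [X in (_ < _ + X)%N](eq_card
    (B := [set j : 'I_n | (T x j < T x j.+1)%R]%SET)); last first.
    by move=> i; rewrite !inE Tstep.
  apply: leq_ltn_trans card_lt.
  (* Distinct pairs may define the same set, which only lowers the multiplicity. *)
  rewrite cardE -(size_map O); apply: uniq_leq_size; first exact: fset_uniq.
  move=> u; rewrite mem_multiplicity; last first.
    by apply: finite_image; exact: finite_finset.
  by move=> /asboolP[[p _ <-] Opx]; apply: map_f; rewrite mem_enum inE.
Qed.

End CoverOrd.

(** * Conditional covering dimension *)

Section CoverDim.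
Variables (R : realType) (X Y : topologicalType) (pi : X -> Y).
Hypothesis X0 : [set: X] !=set0.
Implicit Types U V W : set (set X).

Lemma cover_dim_rel_le U W : finite_open_cover [set: X] W ->
  refines (cover_join (fibers pi) W) U ->
  cover_dim_rel R pi U <= cover_ord R [set: X] W.
Proof.
move=> oW WU; apply: ge_inf; last by exists W.
by exists 0 => r [V [oV _] <-]; exact: cover_ord_ge0.
Qed.

Lemma le_cover_dim_rel U (c : R) : finite_open_cover [set: X] U ->
  (forall W, finite_open_cover [set: X] W ->
    refines (cover_join (fibers pi) W) U -> c <= cover_ord R [set: X] W) ->
  c <= cover_dim_rel R pi U.
Proof.
move=> oU cW; apply: lb_le_inf => [|r [W [oW WU] <-]]; last exact: cW.
exists (cover_ord R [set: X] U), U => //; split=> // _ [P _ [u Uu <-]].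
by exists u => //; exact: subIsetr.
Qed.

Lemma cover_dim_rel_ge0 U : finite_open_cover [set: X] U ->
  0 <= cover_dim_rel R pi U.
Proof.
by move=> oU; apply: le_cover_dim_rel => // W oW _; exact: cover_ord_ge0.
Qed.

Lemma cover_dim_fiber_le (y : Y) U : pi @^-1` [set y] !=set0 ->
  finite_open_cover [set: X] U ->
  cover_dim R (pi @^-1` [set y]) (restrict_cover (pi @^-1` [set y]) U)
    <= cover_dim_rel R pi U.
Proof.
set K := pi @^-1` [set y] => K0 oU; apply: le_cover_dim_rel => // W oW WU.
have [finW opW cW] := (open_coverTP W).1 oW.
apply: (@le_trans _ _ (cover_ord R K (restrict_cover K W))).
  apply: ge_inf.
    by exists 0 => r [V [oV _] <-]; exact: cover_ord_ge0.
  exists (restrict_cover K W) => //; split.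
    split; first exact: finite_image.
      pose P (u : set X) (o : set X) := restrict_cover K W u -> open o /\ u = K `&` o.
      have [g gP] : {g : set X -> set X & forall u, P u (g u)}.
        apply: (@choice _ _ P) => u.
        have [[w Ww <-]|nu] := pselect (restrict_cover K W u).
          by exists w => _; split; [exact: opW|rewrite setIC].
        by exists set0 => /nu.
      by exists g => u /gP[].
    apply/seteqP; split=> [x [_ [w Ww <-] []]//|x Kx].
    have [w Ww wx] := cover_ex x cW.
    by exists (w `&` K) => //; exists w.
  move=> _ [w Ww <-]; have [u Uu wu] : exists2 u, U u & K `&` w `<=` u.
    by apply: WU; exists K; [exists y|exists w].
  by exists (u `&` K); [exists u|move=> x [wx Kx]; split => //; apply: wu].
apply: cover_ord_le => // x Kx.
apply: le_trans (multiplicity_le_ord _ finW (I : [set: X] x)).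
by rewrite ler_nat; apply: multiplicity_image => // w _ [].
Qed.

End CoverDim.

(** * Iterated covers and choices of members *)

Section IteratedCover.
Variables (G : groupType) (X : topologicalType) (act : G -> X -> X).
Hypothesis act_cont : continuous_action act.
Implicit Types (U : set (set X)) (A F : {fset G}).

(** The intersection of the sets [s^-1 v(s)]. Describing members of an iterated cover by a choice
    [v] makes it possible to glue choices over a union and to reindex them under translation. *)
Definition cylinder (l : seq G) (v : G -> set X) : set X :=
  [set x | forall s, s \in l -> v s (act s x)].

Lemma iterated_cover_open U F : finite_open_cover [set: X] U ->
  finite_open_cover [set: X] (iterated_cover act U F).
Proof.
move=> oU; rewrite /iterated_cover.
apply: (big_ind (finite_open_cover [set: X])) => [|V W|s _].
- exact: open_cover_setT.
- exact: open_cover_join.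
- by apply: open_cover_preimage => //; case: act_cont.
Qed.

Lemma cylinder_iterated U F v : (forall s, s \in F -> U (v s)) ->
  iterated_cover act U F (cylinder F v).
Proof.
move=> Uv; have {Uv} : forall s, s \in enum_fset F -> U (v s) by exact: Uv.
rewrite /iterated_cover; elim: (enum_fset F) => [|s l IH] Uv.
  by rewrite big_nil; apply/seteqP; split=> // x _ s.
rewrite big_cons; exists (act s @^-1` v s).
  by exists (v s) => //; apply: Uv; rewrite mem_head.
exists (cylinder l v).
  by apply: IH => t tl; apply: Uv; rewrite in_cons tl orbT.
apply/seteqP; split=> [x [vs vl] t|x vx]; last first.
  split; first by apply: vx; rewrite mem_head.
  by move=> t tl; apply: vx; rewrite in_cons tl orbT.
by rewrite in_cons => /orP[/eqP->|/vl].
Qed.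

Lemma iterated_cylinder U F u : iterated_cover act U F u ->
  exists2 v, forall s, s \in F -> U (v s) & u `<=` cylinder F v.
Proof.
move=> Fu.
suff: exists2 v, forall s, s \in enum_fset F -> U (v s) & u `<=` cylinder F v.
  by case=> v Uv; exists v.
move: Fu; rewrite /iterated_cover; move: (fset_uniq F).
elim: (enum_fset F) u => [|s l IH] u /=.
  by move=> _ _; exists (fun=> set0).
rewrite big_cons => /andP[sl /IH{}IH] [_ [w Uw <-] [u' /IH[v Uv u'v] <-]].
exists (fun t => if t == s then w else v t) => [t|x [wx u'x] t].
  by rewrite in_cons; case: eqP => //= _; exact: Uv.
by rewrite in_cons; case: eqP => [-> //|_ /= tl]; apply: u'v.
Qed.

End IteratedCover.

(** * Subadditivity and invariance of the conditional dimension *)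

Section MeanDimension.
Variables (R : realType) (G : groupType) (X Y : topologicalType).
Variables (actX : G -> X -> X) (actY : G -> Y -> Y) (pi : X -> Y).
Hypotheses (Xsys : dynamical_system R actX) (pi_factor : factor_map actX actY pi).
Variables (U : set (set X)) (oU : finite_open_cover [set: X] U).
Implicit Types A B F : {fset G}.

Let h F := cover_dim_rel R pi (iterated_cover actX U F).

Let X0 : [set: X] !=set0. Proof. by case: Xsys. Qed.
Let act_cont : continuous_action actX. Proof. by case: Xsys. Qed.
Let itU F : finite_open_cover [set: X] (iterated_cover actX U F).
Proof. exact: iterated_cover_open. Qed.

Lemma iterated_dim_fset0 : h fset0 <= 0.
Proof.
have oT := open_cover_setT X.
apply: (@le_trans _ _ (cover_ord R [set: X] [set setT])).
  apply: cover_dim_rel_le => // u _; exists setT; last exact: subsetT.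
  by rewrite /iterated_cover big_nil.
apply: cover_ord_le => // x _; rewrite add0r (_ : 1 = 1%:R)// ler_nat.
rewrite -(cardfs1 [set: X]) fsubset_leq_card//; apply/fsubsetP => u.
by rewrite mem_multiplicity// => /asboolP[-> _]; rewrite in_fset1.
Qed.

(** Arbitrary competitors for the two terms have a common refinement whose order is at most the sum
    of theirs; within a fiber, each of its members determines choices over [A] and over [B], which
    are glued. *)
Lemma iterated_dim_fsetU A B : h (A `|` B)%fset <= h A + h B.
Proof.
have mX : metrizable R X by case: Xsys.
rewrite -lerBlDl; apply: le_cover_dim_rel => // W2 oW2 W2B.
rewrite lerBlDl -lerBlDr; apply: le_cover_dim_rel => // W1 oW1 W1A.
rewrite lerBlDr.
have [W [oW Wref multW]] := join_refinement mX oW1 oW2.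
apply: (@le_trans _ _ (cover_ord R [set: X] W)).
  apply: cover_dim_rel_le => // _ [P PY [w /Wref[_ [w1 W1w [w2 W2w <-]] w12] <-]].
  have [a /iterated_cylinder[v1 Uv1 av1] Pa] : exists2 a,
      iterated_cover actX U A a & P `&` w1 `<=` a.
    by apply: W1A; exists P => //; exists w1.
  have [b /iterated_cylinder[v2 Uv2 bv2] Pb] : exists2 b,
      iterated_cover actX U B b & P `&` w2 `<=` b.
    by apply: W2B; exists P => //; exists w2.
  pose v s := if s \in A then v1 s else v2 s.
  exists (cylinder actX (A `|` B)%fset v).
    apply: cylinder_iterated => s; rewrite in_fsetU /v.
    by case: ifP => [sA _|_ /= sB]; [exact: Uv1|exact: Uv2].
  move=> x [Px /w12[w1x w2x]] s; rewrite in_fsetU /v.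
  case: ifP => [sA _|_ /= sB].
    by apply: (av1 x) => //; apply: Pa.
  by apply: (bv2 x) => //; apply: Pb.
(* The strict inequality between multiplicities is what the [- 1] in each of the three orders
   demands. *)
apply: cover_ord_le => // x Xx.
have [fin1 fin2] : finite_set W1 /\ finite_set W2 by split; [case: oW1|case: oW2].
have := multiplicity_le_ord R fin1 Xx; have := multiplicity_le_ord R fin2 Xx.
by have := multW x; rewrite -(ler_nat R) -natr1 natrD; lra.
Qed.

(** A competitor is pulled back by [c]: equivariance sends the fiber over [y] into the fiber over
    [c y], and the choice at [s] becomes the one at [s c^-1], since [s] acts as [c] followed by
    [s c^-1]. *)
Lemma iterated_dim_rtrans A c : h (rtrans A c) <= h A.
Proof.
have [_ equiv _] := pi_factor; have [_ actM actC] := act_cont.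
apply: le_cover_dim_rel => // W oW WA; have [finW _ _] := oW.
apply: (@le_trans _ _ (cover_ord R [set: X] [set actX c @^-1` w | w in W])).
  apply: cover_dim_rel_le => //; first exact: open_cover_preimage.
  move=> _ [_ [y _ <-] [_ [w Ww <-] <-]].
  have [a /iterated_cylinder[v Uv av] Pa] : exists2 a,
      iterated_cover actX U A a & pi @^-1` [set actY c y] `&` w `<=` a.
    by apply: WA; exists (pi @^-1` [set actY c y]); [exists (actY c y)|exists w].
  exists (cylinder actX (rtrans A c) (fun s => v (s * c^-1)%g)).
    by apply: cylinder_iterated => s; rewrite mem_rtrans; exact: Uv.
  move=> x [/= pix wx] s; rewrite mem_rtrans => sA.
  rewrite -{2}(mulgVK c s) actM; apply: (av (actX c x)) => //.
  by apply: Pa; split => //=; rewrite equiv pix.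
apply: cover_ord_le => // x _.
apply: le_trans (multiplicity_le_ord R finW (I : [set: X] (actX c x))).
by rewrite ler_nat; apply: multiplicity_image.
Qed.

Lemma cvg_iterated_dim : amenable R G ->
  cvg (h F / #|` F|%:R @[F --> @amenable_filter R G]).
Proof.
apply: ornstein_weiss.
- by move=> F; exact: cover_dim_rel_ge0.
- exact: iterated_dim_fset0.
- exact: iterated_dim_fsetU.
- exact: iterated_dim_rtrans.
Qed.

End MeanDimension.

(** * Comparison along the Følner sequence *)

Lemma le_limn_einf (R : realType) (u v : (\bar R)^nat) :
  (forall n, (u n <= v n)%E) -> (limn_einf u <= limn_einf v)%E.
Proof.
move=> uv; rewrite !limn_einf_lim; apply: lee_lim; try exact: is_cvg_einfs.
apply: nearW => n; apply: le_ereal_inf_tmp => _ [k nk <-].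
by apply: ge_ereal_inf; exists (u k) => //; exists k.
Qed.

Local Open Scope ereal_scope.

Theorem proposition2p16 (R : realType) (G : groupType)
    (Gcountable : countable [set: G]) (Gamenable : amenable R G)
    (F_ : nat -> {fset G}) (F_folner : folner_sequence R F_)
    (X Y : topologicalType) (actX : G -> X -> X) (actY : G -> Y -> Y)
    (Xsys : dynamical_system R actX) (Ysys : dynamical_system R actY)
    (pi : X -> Y) (pi_factor : factor_map actX actY pi) (y : Y) :
  mdim_subset R actX F_ (pi @^-1` [set y]) <= mdim_cond R actX pi.
Proof.
apply: ge_ereal_sup => _ [U oU <-].
set phi := fun E : {fset G} =>
  (cover_dim_rel R pi (iterated_cover actX U E) / #|` E|%:R)%R.
apply: (@le_trans _ _ (lim (phi E @[E --> amenable_filter R]))%:E); last first.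
  by apply: ereal_sup_ubound; exists U.
have PF := amenable_filter_proper Gamenable.
have phi_cvg := cvg_iterated_dim Xsys pi_factor oU Gamenable.
(* A Følner sequence eventually enters every [invariant_fsets K d] with [d > 0], so the limit along
   the filter is also the limit along [F_]. *)
have /(cvg_comp _ _ (folner_cvg F_folner)) phiF_cvg := phi_cvg.
have limF : (phi (F_ n))%:E @[n --> \oo] -->
    (lim (phi E @[E --> amenable_filter R]))%:E.
  by apply: cvg_EFin; [exact: nearW|exact: phiF_cvg].
(* The lower limit of a convergent sequence is its limit, which reduces the claim to a termwise
   comparison. *)
rewrite -(cvg_limn_einf_sup limF).1; apply: le_limn_einf => n.
rewrite lee_fin ler_wpM2r ?invr_ge0//; apply: cover_dim_fiber_le.
- have [_ _ pi_onto] := pi_factor; have : range pi y by rewrite pi_onto.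
  by move=> [x _ <-]; exists x.
- by apply: iterated_cover_open => //; case: Xsys.
Qed.
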